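(* Let $(\theta(t),\omega(t))$, $t\ge 0$, be a solution to the inertial Kuramoto system with frustration $$m\ddot\theta_i(t)+\dot\theta_i(t)=\Omega_i+\frac{K}{N}\sum_{j=1}^N\psi_{ij}\sin(\theta_j(t)-\theta_i(t)+\alpha),\qquad i=1,\dots,N,$$ with $\omega_i=\dot\theta_i$, on a symmetric and connected network. Suppose $\beta,\gamma,D^\infty,\delta,c$ are positive constants such that, with $\eta=1-\frac{2}{c}$ and $S_c=\sum_{n=0}^{N-1}c^n$, the following hold. (1) $\beta\in(0,\pi)$ and $2mD(\Omega)+4mK\psi_u\sin\alpha+(1+4mK\psi_u\cos\alpha)D_\theta(0)+3mD_\omega(0)<\beta$. (2) $\beta<\gamma<\pi$, $\ 0<D^\infty<\min\{\frac{\pi}{2},\beta\}$, $\ \alpha<\delta<\frac{\pi}{2}-D^\infty$, $\ c>\max\left\{\frac{2}{\cos(D^\infty+\delta)},\frac{2}{1-\frac{\beta}{\gamma}}\right\}$. (3) $$mK<\min\left\{\frac{\eta^2\psi_l\sin\gamma}{16N\psi_u^2S_c\gamma},\ \frac{NS_c}{2\psi_l}\right\},\qquad K>\frac{4(D(\Omega)+2K\psi_u\sin\alpha)NS_c\gamma}{D^\infty\eta\psi_l\cos\alpha\sin\gamma},$$ $$K>\frac{64(D(\Omega)+2K\psi_u\sin\alpha)(D^\infty\cos\alpha+\sin\alpha)N^3\psi_u^2S_c^3\gamma^2}{\eta^3\psi_l^3\cos\alpha\sin^2\gamma}.$$ Let $t_*\ge 0$ be a time (such a time exists under these hypotheses)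 such that for all $t\ge t_*$ $$D_\theta(t)<D^\infty\quad\text{and}\quad F(t)\le\frac{8(D(\Omega)+2K\psi_u\sin\alpha)N^2\psi_uS_c^2\gamma^2}{mK\eta\psi_l^2\cos\alpha\sin^2\gamma},$$ and let $$\mathcal{E}_2(t)=F(t)+\frac{\eta\psi_l}{2N\psi_uS_c}\,mA(t)+2m^2B(t).$$ Then $$\frac{d}{dt}\mathcal{E}_2(t)\le-\frac{K\psi_l}{2NS_c}\,\mathcal{E}_2(t)\qquad\text{for a.e. }t\ge t_*,$$ and moreover $$D_\omega(t)\le\frac{\mathcal{E}_2(t_* )}{\eta}\,e^{-\frac{K\psi_l}{2NS_c}(t-t_* )},\qquad t\ge t_*.$$
   Context: $N\ge 2$ is an integer, $m>0$ (inertia), $K>0$ (coupling strength), $0<\alpha<\frac{\pi}{2}$ (frustration), $\Omega_1,\dots,\Omega_N\in\mathbb{R}$ (natural frequencies). $\Psi=(\psi_{ij})$ is an $N\times N$ matrix with $\psi_{ij}\ge 0$, and $E=\{(j,i):\psi_{ij}>0\}$ is the edge set. The network is symmetric ($\psi_{ij}=\psi_{ji}$) and connected (any two vertices are joined by a path of edges in $E$). The phases satisfy $\theta_i(t)\in\mathbb{R}$; $\omega_i=\dot\theta_i$, $a_i=\dot\omega_i$, $b_i=\dot a_i$. Solutions are real-analytic in $t$. Notation: $D_\theta(t)=\max_i\theta_i(t)-\min_i\theta_i(t)$, $D_\omega(t)=\max_i\omega_i(t)-\min_i\omega_i(t)$, $D(\Omega)=\max_i\Omega_i-\min_i\Omega_i$,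 $\psi_u=\max_{(i,j)\in E}\psi_{ji}$, $\psi_l=\min_{(i,j)\in E}\psi_{ji}$. For $z=(z_1,\dots,z_N)\in\mathbb{R}^N$ let $l_1\cdots l_N$ be a permutation of $\{1,\dots,N\}$ with $z_{l_1}\le\cdots\le z_{l_N}$ and set $$Y_c(z)=\bar z-\underline z,\quad \bar z=\frac{1}{S_c}\sum_{i=1}^Nc^{i-1}z_{l_i},\quad \underline z=\frac{1}{S_c}\sum_{i=1}^Nc^{N-i}z_{l_i}.$$ Then $F(t)=Y_c(\omega(t))$, $A(t)=Y_c(a(t))$, $B(t)=Y_c(b(t))$, where $\omega=(\omega_1,\dots,\omega_N)$, $a=(a_1,\dots,a_N)$, $b=(b_1,\dots,b_N)$ (each with its own, time-dependent ordering permutation). These are locally Lipschitz functions of $t$. *)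

(* Defs.v *)
From HB Require Import structures.
From mathcomp Require Export all_boot all_order all_fingroup all_algebra.
From mathcomp Require Export all_classical all_reals all_analysis.
Export Order.TTheory GRing.Theory Num.Theory.
Export numFieldNormedType.Exports.

Set Implicit Arguments.
Unset Strict Implicit.
Unset Printing Implicit Defensive.

Local Open Scope classical_set_scope.
Local Open Scope ring_scope.

(* Differentiation on the half-line [0, +oo[: the ordinary derivative at t > 0,
   the right derivative at t = 0. *)
Definition derivable_ge0 (R : realType) (f : R -> R) (t : R) : Prop :=
  cvg ((f s - f t) / (s - t) @[s --> within [set s : R | 0 <= s] t^']).

Definition derive_ge0 (R : realType) (f : R -> R) (t : R) : R :=
  lim ((f s - f t) / (s - t) @[s --> within [set s : R | 0 <= s] t^']).

Definition network_edge (R : realType) (N : nat) (psi : 'M[R]_N) : rel 'I_N :=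
  fun j i => 0 < psi i j.

Definition symmetric_network (R : realType) (N : nat) (psi : 'M[R]_N) : Prop :=
  forall i j : 'I_N, psi i j = psi j i.

Definition connected_network (R : realType) (N : nat) (psi : 'M[R]_N) : Prop :=
  forall i j : 'I_N, connect (network_edge psi) i j.

(* The sets below are finite, and nonempty when 2 <= N and (for the edges) when
   the network is connected, so sup and inf are maximum and minimum. *)
Definition psi_upper (R : realType) (N : nat) (psi : 'M[R]_N) : R :=
  sup [set psi e.2 e.1 | e in [set e : 'I_N * 'I_N | network_edge psi e.1 e.2]].

Definition psi_lower (R : realType) (N : nat) (psi : 'M[R]_N) : R :=
  inf [set psi e.2 e.1 | e in [set e : 'I_N * 'I_N | network_edge psi e.1 e.2]].

Definition diam (R : realType) (N : nat) (z : 'I_N -> R) : R :=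
  sup (range z) - inf (range z).

(* The (k+1)-th smallest value of z, i.e. z_{l_{k+1}} for any permutation l
   putting the values of z in nondecreasing order. *)
Definition order_stat (R : realType) (N : nat) (z : 'I_N -> R) (k : nat) : R :=
  nth 0 (sort <=%R (codom z)) k.

Lemma order_statE (R : realType) (N : nat) (z : 'I_N -> R) (l : 'S_N) :
    (forall i j : 'I_N, (i <= j)%N -> z (l i) <= z (l j)) ->
  forall i : 'I_N, order_stat z i = z (l i).
Proof.
move=> l_sorted i; rewrite /order_stat.
have -> : sort <=%R (codom z) = [seq z (l j) | j <- enum 'I_N].
  apply: (sorted_eq le_trans le_anti).
  - exact: (sort_sorted (@le_total _ R)).
  - rewrite sorted_map; apply: (@sub_sorted _ (fun i j : 'I_N => (i <= j)%N)).
      by move=> a b; exact: l_sorted.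
    by have := iota_sorted 0 N; rewrite -val_enum_ord sorted_map.
  - rewrite perm_sort /codom /image_mem.
    rewrite (map_comp z l); apply: perm_map.
    apply: uniq_perm; first exact: enum_uniq.
      by rewrite (map_inj_uniq perm_inj) enum_uniq.
    move=> x; rewrite mem_enum inE; symmetry.
    apply/mapP; exists ((l^-1)%g x); first by rewrite mem_enum.
    by rewrite permKV.
by rewrite (nth_map i) ?size_enum_ord // nth_ord_enum.
Qed.

Definition geom_sum (R : realType) (N : nat) (c : R) : R :=
  \sum_(n < N) c ^+ n.

(* Indices start at 0 here: c^{i-1} and c^{N-i} become c ^+ i and
   c ^+ (N - i.+1). *)
Definition Ybar (R : realType) (N : nat) (c : R) (z : 'I_N -> R) : R :=
  (geom_sum N c)^-1 * \sum_(i < N) c ^+ i * order_stat z i.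

Definition Yund (R : realType) (N : nat) (c : R) (z : 'I_N -> R) : R :=
  (geom_sum N c)^-1 * \sum_(i < N) c ^+ (N - i.+1) * order_stat z i.

Definition Y (R : realType) (N : nat) (c : R) (z : 'I_N -> R) : R :=
  Ybar c z - Yund c z.

Definition omega (R : realType) (N : nat) (theta : 'I_N -> R -> R) :
    'I_N -> R -> R :=
  fun i => derive_ge0 (theta i).

Definition acc (R : realType) (N : nat) (theta : 'I_N -> R -> R) :
    'I_N -> R -> R :=
  fun i => derive_ge0 (omega theta i).

Definition jerk (R : realType) (N : nat) (theta : 'I_N -> R -> R) :
    'I_N -> R -> R :=
  fun i => derive_ge0 (acc theta i).

(* Higher regularity of theta is not required: it follows from the equation. *)
Definition kuramoto_solution (R : realType) (N : nat) (m K alpha : R)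
    (Omega : 'I_N -> R) (psi : 'M[R]_N) (theta : 'I_N -> R -> R) : Prop :=
  forall (i : 'I_N) (t : R), 0 <= t ->
    [/\ derivable_ge0 (theta i) t,
        derivable_ge0 (omega theta i) t &
        m * acc theta i t + omega theta i t =
          Omega i + K / N%:R *
            \sum_(j < N) psi i j * sin (theta j t - theta i t + alpha)].

Definition F (R : realType) (N : nat) (c : R) (theta : 'I_N -> R -> R)
    (t : R) : R :=
  Y c (fun i => omega theta i t).

Definition A (R : realType) (N : nat) (c : R) (theta : 'I_N -> R -> R)
    (t : R) : R :=
  Y c (fun i => acc theta i t).

Definition B (R : realType) (N : nat) (c : R) (theta : 'I_N -> R -> R)
    (t : R) : R :=
  Y c (fun i => jerk theta i t).

Definition eta (R : realType) (c : R) : R := 1 - 2 / c.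

Definition E2 (R : realType) (N : nat) (m c : R) (psi : 'M[R]_N)
    (theta : 'I_N -> R -> R) (t : R) : R :=
  F c theta t
  + eta c * psi_lower psi / (2 * N%:R * psi_upper psi * geom_sum N c)
    * (m * A c theta t)
  + 2 * m ^+ 2 * B c theta t.

(* Main.v *)
Require Import Defs.
From mathcomp Require Import zify ring lra.

(* By the rearrangement inequality, Y c z is the maximum over permutations l of
   sum_i w_i z_(l i), where w_i = (c^i - c^(N-1-i)) / S_c is strictly increasing
   and antisymmetric, and the maximum is attained exactly at the l sorting z.
   Hence E2 is a finite maximum of differentiable functions.  It is
   differentiable outside the countable set of transversal crossings of two
   branches, with the derivative of any active branch, and it decays as soon as
   every active branch does.

   For an active branch put lam = K psi_l / (2 N S_c).  Pairing the edges (i, j)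
   and (j, i) bounds the coupling part of F' by - 4 lam D_omega, and
   differentiating the equation once and twice gives
     F' <= - 4 lam F + m B,
     m A' <= - A + 2 K psi_u F / eta,
     2 m^2 B' <= - 2 m B + 4 m K psi_u A / eta + lam F,
   where the assumed bound on F absorbs the quadratic term of B'.  The weighted
   sum of these is at most - lam E2. *)

Set Implicit Arguments.
Unset Strict Implicit.
Unset Printing Implicit Defensive.

Local Open Scope classical_set_scope.
Local Open Scope ring_scope.

(** * Weighted sums of ordered values *)

Definition rank_weight (R : realType) (N : nat) (c : R) (i : 'I_N) : R :=
  (geom_sum N c)^-1 * (c ^+ i - c ^+ (N - i.+1)).

Definition rank_sum (R : realType) (N : nat) (c : R) (l : 'S_N)
    (z : 'I_N -> R) : R :=
  \sum_(i < N) rank_weight c i * z (l i).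

Definition sorts (R : realType) (N : nat) (l : 'S_N) (z : 'I_N -> R) : Prop :=
  forall i j : 'I_N, (i <= j)%N -> z (l i) <= z (l j).

Lemma geom_sum_gt0 (R : realType) (N : nat) (c : R) :
  (0 < N)%N -> 0 < c -> 0 < geom_sum N c.
Proof.
case: N => // n _ c0; rewrite /geom_sum big_ord_recl expr0.
by rewrite ltr_pwDl// sumr_ge0// => i _; rewrite exprn_ge0// ltW.
Qed.

Lemma geom_sum_rev (R : realType) (N : nat) (c : R) :
  \sum_(i < N) c ^+ (N - i.+1) = geom_sum N c.
Proof. by rewrite [RHS](reindex_inj rev_ord_inj). Qed.

Lemma rank_weight_rev (R : realType) (N : nat) (c : R) (i : 'I_N) :
  rank_weight c (rev_ord i) = - rank_weight c i.
Proof.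
rewrite /rank_weight/= subnSK// subKn ?(ltnW (ltn_ord i))//.
by rewrite -mulrN opprB.
Qed.

Lemma rank_weight_mono (R : realType) (N : nat) (c : R) (i j : 'I_N) :
  1 < c -> (i < j)%N -> rank_weight c i < rank_weight c j.
Proof.
move=> c1 ij; rewrite /rank_weight.
have N0 : (0 < N)%N by exact: leq_ltn_trans (ltn_ord i).
rewrite ltr_pM2l ?invr_gt0 ?geom_sum_gt0//; last by lra.
apply: ltrB; rewrite ltr_eXn2l//.
by have := ltn_ord j; lia.
Qed.

(** Reversing the positions negates the antisymmetric weights, so the rank sums of [z] form a set
    symmetric about zero. This is what bounds them below by [- Y c z]. *)
Lemma rank_sumN (R : realType) (N : nat) (c : R) (l : 'S_N) (z : 'I_N -> R) :
  - rank_sum c l z = rank_sum c (perm rev_ord_inj * l)%g z.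
Proof.
rewrite /rank_sum -sumrN [LHS](reindex_inj rev_ord_inj); apply: eq_bigr => i _.
by rewrite permM permE rank_weight_rev mulNr opprK.
Qed.

Lemma rank_sum_linear (R : realType) (N : nat) (c : R) (l : 'S_N)
    (a b : R) (x y : 'I_N -> R) :
  rank_sum c l (fun i => a * x i + b * y i) =
  a * rank_sum c l x + b * rank_sum c l y.
Proof.
rewrite /rank_sum !mulr_sumr -big_split/=; apply: eq_bigr => i _; ring.
Qed.

(* Swapping an inverted pair of an unsorted arrangement increases the sum, since
   the weights are strictly increasing. *)
Lemma rank_sum_opt_sorts (R : realType) (N : nat) (c : R) (l : 'S_N)
    (z : 'I_N -> R) :
  1 < c -> (forall l', rank_sum c l' z <= rank_sum c l z) -> sorts l z.
Proof.
move=> c1 lmax i j; rewrite leq_eqVlt => /orP[/eqP/val_inj -> //|ij].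
rewrite leNgt; apply/negP => zij.
have := lmax (tperm i j * l)%g; apply/negP; rewrite -ltNge.
have nij : j != i by rewrite neq_ltn ij orbT.
rewrite /rank_sum (bigD1 i)//= (bigD1 j)//= [ltRHS](bigD1 i)//=.
rewrite [X in _ < _ + X](bigD1 j)//=.
rewrite !permM tpermL tpermR !addrA.
rewrite [X in _ < _ + X](_ : _ =
    \sum_(k < N | (k != i) && (k != j)) rank_weight c k * z (l k)); last first.
  apply: eq_bigr => k /andP[ki kj].
  by rewrite permM tpermD// eq_sym.
have := rank_weight_mono c1 ij.
rewrite ltrD2r.
move=> h; rewrite -subr_gt0.
suff : 0 < (rank_weight c j - rank_weight c i) * (z (l i) - z (l j)) by lra.
by rewrite mulr_gt0// subr_gt0.
Qed.

Lemma Y_sorts (R : realType) (N : nat) (c : R) (l : 'S_N) (z : 'I_N -> R) :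
  sorts l z -> Y c z = rank_sum c l z.
Proof.
move=> lz; rewrite /Y /Ybar /Yund /rank_sum -mulrBr -sumrB mulr_sumr.
by apply: eq_bigr => i _; rewrite (order_statE lz) /rank_weight; ring.
Qed.

(** A sorting permutation is obtained as a maximizer over the finite group ['S_N]: optimality forces
    sortedness, and every sorting permutation gives the value [Y c z]. *)
Lemma Y_max (R : realType) (N : nat) (c : R) (z : 'I_N -> R) : 1 < c ->
  (exists l : 'S_N, Y c z = rank_sum c l z /\ sorts l z) /\
  (forall l : 'S_N, rank_sum c l z <= Y c z).
Proof.
move=> c1.
pose l0 := [arg max_(l > 1%g : 'S_N) rank_sum c l z]%O.
have l0P l : rank_sum c l z <= rank_sum c l0 z.
  by rewrite /l0; case: arg_maxP => // x _ /(_ l); apply.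
have s0 := rank_sum_opt_sorts c1 l0P.
by have Yl0 := Y_sorts c s0; split; [exists l0|move=> l; rewrite Yl0].
Qed.

Lemma rank_sum_le_Y (R : realType) (N : nat) (c : R) (l : 'S_N)
    (z : 'I_N -> R) : 1 < c -> rank_sum c l z <= Y c z.
Proof. by move=> /(Y_max z)[_]. Qed.

Lemma rank_sum_ge_NY (R : realType) (N : nat) (c : R) (l : 'S_N)
    (z : 'I_N -> R) : 1 < c -> - Y c z <= rank_sum c l z.
Proof. by move=> c1; rewrite lerNl rank_sumN rank_sum_le_Y. Qed.

(** Turns activity of a branch into an ordering of the values, which the edge-pairing estimates
    require. *)
Lemma rank_sum_active (R : realType) (N : nat) (c : R) (l : 'S_N)
    (z : 'I_N -> R) : 1 < c -> rank_sum c l z = Y c z -> sorts l z.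
Proof.
by move=> c1 lY; apply: (rank_sum_opt_sorts c1) => l'; rewrite lY rank_sum_le_Y.
Qed.

(** A rank sum is the difference of two weighted means of [z], with weights [c ^+ i / S_c] in
    increasing and in reversed order; each mean lies in [[v, u]]. *)
Lemma rank_sum_le (R : realType) (N : nat) (c : R) (l : 'S_N)
    (z : 'I_N -> R) (u v : R) : (0 < N)%N -> 0 < c ->
  (forall i, v <= z i <= u) -> rank_sum c l z <= u - v.
Proof.
move=> N0 c0 zuv; have S0 := geom_sum_gt0 N0 c0.
rewrite /rank_sum (_ : \sum_(i < N) _ = (geom_sum N c)^-1 *
   (\sum_(i < N) c ^+ i * z (l i)
    - \sum_(i < N) c ^+ (N - i.+1) * z (l i))); last first.
  rewrite -sumrB mulr_sumr; apply: eq_bigr => i _.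
  by rewrite /rank_weight; ring.
rewrite -(ler_pM2l S0) mulrA divff ?gt_eqF// mul1r mulrBr.
apply: lerB.
  rewrite {1}/geom_sum mulr_suml ler_sum// => i _.
  by rewrite ler_wpM2l ?exprn_ge0 ?(ltW c0)//; case/andP: (zuv (l i)).
rewrite -geom_sum_rev mulr_suml ler_sum// => i _.
by rewrite ler_wpM2l ?exprn_ge0 ?(ltW c0)//; case/andP: (zuv (l i)).
Qed.

Lemma diam_extrema (R : realType) (N : nat) (z : 'I_N -> R) : (0 < N)%N ->
  exists u v : 'I_N,
    [/\ diam z = z u - z v, forall i, z i <= z u & forall i, z v <= z i].
Proof.
case: N z => // n z _.
pose u := [arg max_(i > ord0 : 'I_n.+1) z i]%O.
pose v := [arg min_(i < ord0 : 'I_n.+1) z i]%O.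
have uP i : z i <= z u by rewrite /u; case: arg_maxP => // x _; apply.
have vP i : z v <= z i by rewrite /v; case: arg_minP => // x _; apply.
exists u, v; split => //; rewrite /diam.
congr (_ - _); apply/le_anti/andP; split.
- by apply: ge_sup; [exists (z ord0), ord0|move=> _ [i _ <-]].
- by apply: ub_le_sup; [exists (z u) => _ [i _ <-]|exists u].
- by apply: ge_inf; [exists (z v) => _ [i _ <-]|exists v].
- by apply: lb_le_inf; [exists (z ord0), ord0|move=> _ [i _ <-]].
Qed.

Lemma diam_ge (R : realType) (N : nat) (z : 'I_N -> R) (i j : 'I_N) :
  `|z i - z j| <= diam z.
Proof.
have N0 : (0 < N)%N by exact: leq_ltn_trans (ltn_ord i).
have [u [v [-> uP vP]]] := diam_extrema z N0.
move: (uP i) (uP j) (vP i) (vP j) => ui uj vi vj.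
by rewrite ler_norml; apply/andP; split; lra.
Qed.

Lemma diam_ge0 (R : realType) (N : nat) (z : 'I_N -> R) :
  (0 < N)%N -> 0 <= diam z.
Proof. by case: N z => // n z _; apply: le_trans (diam_ge z ord0 ord0). Qed.

Lemma Y_le_diam (R : realType) (N : nat) (c : R) (z : 'I_N -> R) :
  (0 < N)%N -> 1 < c -> Y c z <= diam z.
Proof.
move=> N0 c1; have [[l [-> _]] _] := Y_max z c1.
have [u [v [-> uP vP]]] := diam_extrema z N0.
by apply: rank_sum_le => //; [lra|move=> i; rewrite uP vP].
Qed.

Lemma rank_weight_last (R : realType) (n : nat) (c : R) : 2 < c ->
  eta c <= rank_weight c (@ord_max n.+1).
Proof.
move=> c2; rewrite /rank_weight/= subnn expr0 mulrC /eta.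
have S0 : 0 < geom_sum n.+2 c by apply: geom_sum_gt0 => //; lra.
rewrite ler_pdivlMr//.
(* With the closed form of the geometric sum the claim becomes polynomial in [c], apart from a term
   [2 / c <= 1]. *)
have -> : geom_sum n.+2 c = (c ^+ n.+2 - 1) / (c - 1).
  by rewrite [in RHS]subrX1 mulrAC divff ?mul1r//; lra.
rewrite mulrA ler_pdivrMr; last lra.
have c_ne0 : c != 0 by lra.
have -> : (1 - 2 / c) * (c ^+ n.+2 - 1) =
   c ^+ n.+2 - 2 * c ^+ n.+1 - 1 + 2 / c.
  by rewrite exprS; field.
have cn : 1 <= c ^+ n by rewrite exprn_ege1//; lra.
have : 2 / c <= 1 by rewrite ler_pdivrMr; lra.
rewrite !exprS; nra.
Qed.

(** Together with [Y_le_diam] this makes [Y c] comparable to the diameter. It converts the bounds in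
    terms of diameters into bounds in terms of F and A, and at the end E2 into a bound on the
    frequency diameter. *)
Lemma eta_diam_le_Y (R : realType) (N : nat) (c : R) (z : 'I_N -> R) :
  (2 <= N)%N -> 2 < c -> eta c * diam z <= Y c z.
Proof.
case: N z => [//|[//|n]] z _ c2.
have c1 : 1 < c by lra.
have [[l [-> lz]] _] := Y_max z c1.
have [u [v [-> _ _]]] := diam_extrema z (ltn0Sn _).
have zu : z u <= z (l ord_max).
  by rewrite -[u](permKV l); apply: lz; rewrite leq_ord.
have zv : z (l ord0) <= z v by rewrite -[v](permKV l); exact: lz.
(* By antisymmetry of the weights, pairing i with rev_ord i writes 2 Y as a sum
   of nonnegative terms; the two extreme ones already give the bound. *)
have key : 2 * rank_sum c l z =
    \sum_(i < n.+2) rank_weight c i * (z (l i) - z (l (rev_ord i))).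
  rewrite mulr2n mulrDl mul1r {2}/rank_sum (reindex_inj rev_ord_inj)/=.
  rewrite -big_split/=; apply: eq_bigr => i _; rewrite rank_weight_rev; ring.
have pos (i : 'I_n.+2) : 0 <= rank_weight c i * (z (l i) - z (l (rev_ord i))).
  have [ir|ri] := leqP i (rev_ord i).
    have wi : rank_weight c i <= rank_weight c (rev_ord i).
      move: ir; rewrite leq_eqVlt => /orP[/eqP/val_inj <- //|ir].
      exact/ltW/rank_weight_mono.
    rewrite rank_weight_rev in wi.
    have zi := lz _ _ ir; apply: mulr_le0; lra.
  have := rank_weight_mono c1 ri; rewrite rank_weight_rev => wi.
  have zi := lz _ _ (ltnW ri); apply: mulr_ge0; lra.
move: key; rewrite (bigD1 ord_max)//= (bigD1 ord0)//=.
have -> : rev_ord (@ord_max n.+1) = ord0 by apply/val_inj; rewrite /= subnn.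
have r0 : rev_ord (@ord0 n.+1) = ord_max.
  by apply/val_inj; rewrite /= subSS subn0.
have w0 : rank_weight c (@ord0 n.+1) = - rank_weight c (@ord_max n.+1).
  by rewrite -r0 rank_weight_rev opprK.
rewrite r0 w0.
have : 0 <= \sum_(i < n.+2 | (i != ord_max) && (i != ord0))
    rank_weight c i * (z (l i) - z (l (rev_ord i))) by apply: sumr_ge0.
have /= := rank_weight_last n c2.
have eta0 : 0 <= eta c.
  by rewrite /eta subr_ge0 ler_pdivrMr; lra.
have := lz ord0 ord_max (leq0n _).
set w := rank_weight _ _; set X := \sum_(i < _ | _) _.
set a := z (l ord0) in zv *; set b := z (l ord_max) in zu *.
move=> ab etaw X0 eq.
have : eta c * (z u - z v) <= eta c * (b - a) by rewrite ler_wpM2l//; lra.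
have : eta c * (b - a) <= w * (b - a) by rewrite ler_wpM2r// subr_ge0.
lra.
Qed.

Lemma Y_ge0 (R : realType) (N : nat) (c : R) (z : 'I_N -> R) :
  (2 <= N)%N -> 2 < c -> 0 <= Y c z.
Proof.
move=> N2 c2; apply: le_trans (eta_diam_le_Y z N2 c2).
rewrite mulr_ge0 ?diam_ge0 ?(ltnW N2)// /eta subr_ge0 ler_pdivrMr; lra.
Qed.

(** * Coupling along the network *)

(* The coupling coefficients a, b of an edge and of its reverse may differ by a
   factor c / 2, which one extra power of c compensates up to a factor 2. *)
Lemma rank_weight_gap (R : realType) (N : nat) (c : R) (i j : 'I_N)
    (p a b : R) : 2 < c -> (i < j)%N -> 0 <= p ->
  2 / c * p <= a <= p -> 2 / c * p <= b <= p ->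
  2 * p <= (c ^+ j - c ^+ (N - j.+1)) * b - (c ^+ i - c ^+ (N - i.+1)) * a.
Proof.
move=> c2 ij p0 pa pb.
(* Since [r >= 2 / c * p], the larger power gives [c ^+ d * r >= 2 * c ^+ d.-1 * p], while
   [c ^+ k * q] costs at most [c ^+ d.-1 * p]. *)
have step (k d : nat) (q r : R) : (k < d)%N -> 2 / c * p <= q <= p ->
    2 / c * p <= r <= p -> p <= c ^+ d * r - c ^+ k * q.
  case: d => // d; rewrite ltnS => kd /andP[_ qp] /andP[pr _].
  have ckd : c ^+ k <= c ^+ d by rewrite ler_weXn2l//; lra.
  have ck1 : 1 <= c ^+ k by rewrite exprn_ege1//; lra.
  have h1 : 2 * c ^+ d * p <= c ^+ d.+1 * r.
    have -> : 2 * c ^+ d * p = c ^+ d.+1 * (2 / c * p).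
      by rewrite exprS; field; lra.
    by rewrite ler_wpM2l// exprn_ge0//; lra.
  have : c ^+ k * q <= c ^+ k * p by rewrite ler_wpM2l// exprn_ge0//; lra.
  have : c ^+ k * p <= c ^+ d * p by rewrite ler_wpM2r.
  have : 1 * p <= c ^+ k * p by rewrite ler_wpM2r.
  lra.
have := step _ _ _ _ ij pa pb.
(* The reversed exponents decrease with the position, so [a] and [b] exchange roles. *)
have ij' : (N - j.+1 < N - i.+1)%N by have := ltn_ord j; lia.
have := step _ _ _ _ ij' pb pa.
lra.
Qed.

(** The coefficients [a] need not be symmetric, so the two directions of an edge do not cancel
    exactly; [rank_weight_gap] shows that their joint contribution still dissipates. *)
Lemma rank_sum_laplacian (R : realType) (N : nat) (c : R) (l : 'S_N)
    (z : 'I_N -> R) (psi : 'M[R]_N) (a : 'I_N -> 'I_N -> R) :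
  (0 < N)%N -> 2 < c -> (forall i j, 0 <= psi i j) -> symmetric_network psi ->
  (forall i j, 2 / c * psi i j <= a i j <= psi i j) -> sorts l z ->
  rank_sum c l (fun i => \sum_j a i j * (z j - z i)) <=
  - ((geom_sum N c)^-1 * \sum_i \sum_j psi i j * `|z j - z i|).
Proof.
move=> N0 c2 psi0 psis ha lz.
have c0 : 0 < c by lra.
pose k (i : 'I_N) := c ^+ i - c ^+ (N - i.+1).
(* Here [i] and [j] are positions in the sorted order, so comparing them decides the sign of the
   difference of values. *)
pose T i j := k i * (a (l i) (l j) * (z (l j) - z (l i))).
have -> : rank_sum c l (fun i => \sum_j a i j * (z j - z i)) =
    (geom_sum N c)^-1 * \sum_i \sum_j T i j.
  rewrite /rank_sum mulr_sumr; apply: eq_bigr => i _.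
  rewrite /rank_weight -mulrA (reindex_inj (@perm_inj _ l))/= mulr_sumr//.
have -> : \sum_i \sum_j psi i j * `|z j - z i| =
    \sum_i \sum_j psi (l i) (l j) * `|z (l j) - z (l i)|.
  rewrite (reindex_inj (@perm_inj _ l))/=; apply: eq_bigr => i _.
  by rewrite (reindex_inj (@perm_inj _ l)).
rewrite -mulrN ler_pM2l ?invr_gt0 ?geom_sum_gt0//.
(* Symmetrizing doubles both sides and leaves an inequality that holds for each pair of positions
   separately. *)
suff : \sum_i \sum_j (T i j + T j i) <=
    \sum_i \sum_j (- (2 * (psi (l i) (l j) * `|z (l j) - z (l i)|))).
  under eq_bigr do rewrite big_split/=.
  rewrite big_split/= [X in _ + X]exchange_big/= -mulr2n.
  have -> : \sum_i \sum_j (- (2 * (psi (l i) (l j) * `|z (l j) - z (l i)|))) =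
     2 * (- \sum_i \sum_j psi (l i) (l j) * `|z (l j) - z (l i)|).
    rewrite mulrN mulr_sumr -sumrN; apply: eq_bigr => i _.
    by rewrite mulr_sumr -sumrN.
  lra.
have main (i j : 'I_N) : (i < j)%N -> T i j + T j i <=
    - (2 * (psi (l i) (l j) * `|z (l j) - z (l i)|)).
  move=> ij; have zij := lz _ _ (ltnW ij).
  rewrite ger0_norm ?subr_ge0// /T.
  have haji := ha (l j) (l i); rewrite [psi _ _]psis in haji.
  have g := rank_weight_gap c2 ij (psi0 (l i) (l j)) (ha (l i) (l j)) haji.
  rewrite -/(k i) -/(k j) in g.
  have : (2 * psi (l i) (l j)) * (z (l j) - z (l i)) <=
     (k j * a (l j) (l i) - k i * a (l i) (l j)) * (z (l j) - z (l i)).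
    by rewrite ler_wpM2r// subr_ge0.
  lra.
apply: ler_sum => i _; apply: ler_sum => j _.
have [ij|ji|/val_inj->] := ltngtP i j; first exact: main.
- by rewrite addrC psis distrC; exact: main.
- by rewrite /T !subrr normr0 !mulr0 addr0 oppr0.
Qed.

(* Along a simple path every vertex is the start of at most one step, so the
   steps embed into the double sum. *)
Lemma path_climb (R : realType) (N : nat) (psi : 'M[R]_N) (m : R)
    (z : 'I_N -> R) (x : 'I_N) (s : seq 'I_N) :
  symmetric_network psi -> (forall i j, 0 <= psi i j) -> 0 <= m ->
  (forall i j, 0 < psi i j -> m <= psi i j) ->
  path (network_edge psi) x s ->
  m * (z (last x s) - z x) <=
  \sum_(i <- x :: s) \sum_j psi i j * Num.max 0 (z j - z i).
Proof.
move=> psis psi0 m0 mpsi; elim: s x => [|y s ih] x /=.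
  move=> _; rewrite subrr mulr0 big_seq1 sumr_ge0// => j _.
  by rewrite mulr_ge0// le_max lexx.
move=> /andP[xy ys]; rewrite big_cons.
have := ih _ ys; set L := z (last y s); set S := \sum_(i <- _) _ => IH.
suff : m * (z y - z x) <= \sum_j psi x j * Num.max 0 (z j - z x) by lra.
rewrite (bigD1 y)//= -[leLHS]addr0; apply: lerD; last first.
  by apply: sumr_ge0 => j _; rewrite mulr_ge0// le_max lexx.
have pxy : m <= psi x y by apply: mpsi; rewrite psis.
apply: (@le_trans _ _ (m * Num.max 0 (z y - z x))).
  by rewrite ler_wpM2l// le_max lexx orbT.
by rewrite ler_wpM2r// le_max lexx.
Qed.

(** A simple path from a minimizer to a maximizer climbs the whole diameter, so the upward
    increments alone contribute [m * diam z]. By symmetry the downward increments contribute as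
    much. *)
Lemma diam_le_coupling (R : realType) (N : nat) (psi : 'M[R]_N) (m : R)
    (z : 'I_N -> R) : (0 < N)%N ->
  symmetric_network psi -> connected_network psi ->
  (forall i j, 0 <= psi i j) -> 0 <= m ->
  (forall i j, 0 < psi i j -> m <= psi i j) ->
  2 * m * diam z <= \sum_i \sum_j psi i j * `|z j - z i|.
Proof.
move=> N0 psis psic psi0 m0 mpsi.
pose P := \sum_i \sum_j psi i j * Num.max 0 (z j - z i).
(* The absolute value splits into positive and negative parts, which symmetry of [psi] makes equal
   after summation. *)
have -> : \sum_i \sum_j psi i j * `|z j - z i| = 2 * P.
  rewrite mulr2n mulrDl mul1r {2}/P [X in _ = _ + X]exchange_big/= -big_split/=.
  apply: eq_bigr => i _; rewrite -big_split/=; apply: eq_bigr => j _.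
  rewrite [psi j i]psis -mulrDr; congr (_ * _).
  rewrite -[z i - z j]opprB; have [h|h] := leP 0 (z j - z i).
    by rewrite ger0_norm// max_l ?addr0// oppr_le0.
  by rewrite ltr0_norm// max_r ?add0r// oppr_ge0 ltW.
have [u [v [-> _ _]]] := diam_extrema z N0.
rewrite -mulrA ler_pM2l//.
have /connectP[s0 vs0 ->] := psic v u.
have [s vs us _] := shortenP vs0.
apply: le_trans (path_climb z psis psi0 m0 mpsi vs) _.
rewrite /P big_uniq//= big_mkcond/=; apply: ler_sum => i _; case: ifP => // _.
by apply: sumr_ge0 => j _; rewrite mulr_ge0// le_max lexx.
Qed.

Lemma psi_le_upper (R : realType) (N : nat) (psi : 'M[R]_N) (i j : 'I_N) :
  (forall i j, 0 <= psi i j) -> 0 < psi i j -> psi i j <= psi_upper psi.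
Proof.
move=> psi0 pij; apply: ub_le_sup; last by exists (j, i).
exists (\sum_i \sum_j psi i j) => _ [[b a] _ <-]/=.
rewrite (bigD1 a)//= (bigD1 b)//= -addrA lerDl addr_ge0// sumr_ge0// => k _.
by apply: sumr_ge0.
Qed.

Lemma psi_ge_lower (R : realType) (N : nat) (psi : 'M[R]_N) (i j : 'I_N) :
  0 < psi i j -> psi_lower psi <= psi i j.
Proof.
move=> pij; apply: ge_inf; last by exists (j, i).
by exists 0 => _ [[b a] /= /ltW e <-].
Qed.

Lemma connected_edge (R : realType) (N : nat) (psi : 'M[R]_N) :
  (2 <= N)%N -> connected_network psi -> exists i j, 0 < psi i j.
Proof.
case: N psi => [//|[//|n]] psi _ /(_ ord0 ord_max)/connectP.
move=> [[|x s]//= /andP[e _] _].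
by exists x, ord0.
Qed.

Lemma psi_lower_gt0 (R : realType) (N : nat) (psi : 'M[R]_N) :
  (2 <= N)%N -> connected_network psi -> 0 < psi_lower psi.
Proof.
move=> N2 psic; have [i [j pij]] := connected_edge N2 psic.
pose e := [arg min_(e < (j, i) | 0 < psi e.2 e.1) psi e.2 e.1]%O.
have [e0 emin] : 0 < psi e.2 e.1 /\
    forall f : 'I_N * 'I_N, 0 < psi f.2 f.1 -> psi e.2 e.1 <= psi f.2 f.1.
  by rewrite /e; case: arg_minP.
apply: lt_le_trans e0 _; apply: lb_le_inf; first by exists (psi i j), (j, i).
by move=> _ [f f0 <-]; exact: emin.
Qed.

(** * The dissipation estimate *)

Lemma cos_norm (R : realType) (x : R) : cos `|x| = cos x.
Proof. by case: (ger0P x) => // _; rewrite cosN. Qed.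

Lemma cos_ge (R : realType) (x y : R) : `|x| <= y -> y <= pi -> cos y <= cos x.
Proof.
move=> xy ypi; rewrite -(cos_norm x); have x0 := normr_ge0 x.
move: xy; rewrite le_eqVlt => /orP[/eqP -> //|xy].
by rewrite ltW// ltr_cos// in_itv/=; apply/andP; split; lra.
Qed.

(** A branch of E2 that attains the total maximum must attain the maximum in each of its three
    summands, because all weights are positive. *)
Lemma weighted_sum_tight (R : realType) (k l m x1 x2 x3 y1 y2 y3 : R) :
  0 < k * m -> 0 < l -> x1 <= y1 -> x2 <= y2 -> x3 <= y3 ->
  x1 + k * (m * x2) + l * x3 = y1 + k * (m * y2) + l * y3 ->
  [/\ x1 = y1, x2 = y2 & x3 = y3].
Proof.
move=> k0 l0 h1 h2 h3; rewrite !(mulrA k) => e.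
have q2 : k * m * x2 <= k * m * y2 by rewrite ler_pM2l.
have q3 : l * x3 <= l * y3 by rewrite ler_pM2l.
split; first lra.
  by apply: (mulfI (lt0r_neq0 k0)); lra.
by apply: (mulfI (lt0r_neq0 l0)); lra.
Qed.

Lemma norm_sin_le (R : realType) (x : R) : `|sin x| <= `|x|.
Proof.
wlog x0 : x / 0 < x.
  move=> h; have [|x0|<-] := ltgtP 0 x; first exact: h.
    by rewrite -normrN -sinN -[leRHS]normrN h// oppr_gt0.
  by rewrite sin0 normr0.
have [|y _] := @MVT R sin cos 0 x x0 (fun y _ => is_derive_sin y).
  by apply: derivable_within_continuous => y _; exact: ex_derive.
rewrite sin0 !subr0 => ->; rewrite normrM -[leRHS]mul1r ler_wpM2r//.
exact: cos_max.
Qed.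

Definition coupling (R : realType) (N : nat) (K : R) (psi : 'M[R]_N)
    (x : 'I_N -> 'I_N -> R) (i : 'I_N) : R :=
  K / N%:R * \sum_(j < N) psi i j * x i j.

Lemma coupling_bound (R : realType) (N : nat) (K : R) (psi : 'M[R]_N)
    (x : 'I_N -> 'I_N -> R) (M : R) (i : 'I_N) :
  (2 <= N)%N -> 0 < K -> (forall i j, 0 <= psi i j) -> connected_network psi ->
  (forall i j, `|x i j| <= M) ->
  `|coupling K psi x i| <= K * psi_upper psi * M.
Proof.
move=> N2 K0 psi0 psic xM.
have N0 : 0 < N%:R :> R by rewrite ltr0n ltnW.
have M0 : 0 <= M by apply: le_trans (xM i i).
rewrite normrM gtr0_norm ?divr_gt0//.
have -> : K * psi_upper psi * M = K / N%:R * (\sum_(j < N) psi_upper psi * M).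
  by rewrite sumr_const card_ord -[_ *+ N]mulr_natl; field; rewrite gt_eqF.
rewrite ler_pM2l ?divr_gt0//.
apply: le_trans (ler_norm_sum _ _ _) _; apply: ler_sum => j _.
rewrite normrM ger0_norm//.
have [e [f pef]] := connected_edge N2 psic.
have pu0 : 0 <= psi_upper psi.
  exact: le_trans (ltW pef) (psi_le_upper psi0 pef).
have pu : psi i j <= psi_upper psi.
  have := psi0 i j; rewrite le_eqVlt => /orP[/eqP <- //|].
  exact: psi_le_upper.
exact: ler_pM.
Qed.

(** Every coupling term lies in an interval of half-width [K * psi_upper psi * M], and a rank sum is
    at most the length of such an interval. *)
Lemma rank_sum_coupling (R : realType) (N : nat) (c K M : R) (l : 'S_N)
    (psi : 'M[R]_N) (x : 'I_N -> 'I_N -> R) :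
  (2 <= N)%N -> 0 < c -> 0 < K -> (forall i j, 0 <= psi i j) ->
  connected_network psi -> (forall i j, `|x i j| <= M) ->
  rank_sum c l (coupling K psi x) <= 2 * K * psi_upper psi * M.
Proof.
move=> N2 c0 K0 psi0 psic xM.
have -> : 2 * K * psi_upper psi * M =
  K * psi_upper psi * M - (- (K * psi_upper psi * M)) by ring.
apply: rank_sum_le => //; first exact: ltnW.
by move=> i; rewrite -ler_norml; exact: coupling_bound.
Qed.

(** In the application [u] is a cosine. Its lower bound [2 / c] is the asymmetry that the geometric
    weights can absorb. *)
Lemma rank_sum_decay (R : realType) (N : nat) (c K : R) (l : 'S_N)
    (psi : 'M[R]_N) (u : 'I_N -> 'I_N -> R) (z : 'I_N -> R) :
  (2 <= N)%N -> 2 < c -> 0 < K -> (forall i j, 0 <= psi i j) ->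
  symmetric_network psi -> connected_network psi ->
  (forall i j, 2 / c <= u i j <= 1) -> sorts l z ->
  rank_sum c l (coupling K psi (fun i j => u i j * (z j - z i))) <=
  - (2 * K * psi_lower psi / (N%:R * geom_sum N c) * diam z).
Proof.
move=> N2 c2 K0 psi0 psis psic hu lz.
have N0 : 0 < N%:R :> R by rewrite ltr0n ltnW.
have S0 : 0 < geom_sum N c by apply: geom_sum_gt0; [exact: ltnW|lra].
have ha i j : 2 / c * psi i j <= psi i j * u i j <= psi i j.
  have /andP[u1 u2] := hu i j; rewrite [2 / c * _]mulrC ler_wpM2l//=.
  by rewrite -[leRHS]mulr1 ler_wpM2l.
have lap := rank_sum_laplacian (ltnW N2) c2 psi0 psis ha lz.
have d := diam_le_coupling z (ltnW N2) psis psic psi0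
  (ltW (psi_lower_gt0 N2 psic)) (@psi_ge_lower _ _ psi).
have -> : rank_sum c l (coupling K psi (fun i j => u i j * (z j - z i))) =
   K / N%:R * rank_sum c l (fun i => \sum_j psi i j * u i j * (z j - z i)).
  rewrite /rank_sum mulr_sumr; apply: eq_bigr => i _; rewrite /coupling.
  by rewrite mulrCA; congr (_ * (_ * _)); apply: eq_bigr => j _; rewrite mulrA.
rewrite -[leRHS]mulNr.
have -> : - (2 * K * psi_lower psi / (N%:R * geom_sum N c)) * diam z =
   K / N%:R * (- ((geom_sum N c)^-1 * (2 * psi_lower psi * diam z))).
  by field; rewrite !gt_eqF.
rewrite ler_pM2l ?divr_gt0//; apply: le_trans lap _.
by rewrite lerN2 ler_pM2l// invr_gt0.
Qed.

(** The real arithmetic of the estimate. [Z] stands for the frequency spread plus the frustration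
    term, [X] for the bound on the sine in the quadratic term, [D] and [DA] for the diameters of
    frequencies and accelerations, and [F1], [A1], [B1] for the slopes of active branches. *)
Lemma decay_arith (R : realType)
    (n S pl pu et K m sg g ca Z X D F A B F1 A1 B1 DA : R) :
  0 < n -> 0 < S -> 0 < pl -> 0 < pu -> 0 < et -> 0 < K -> 0 < m ->
  0 < sg <= g -> 0 < ca -> 0 <= X -> 0 <= F -> 0 <= A -> 0 <= B ->
  0 <= D -> F <= D -> et * D <= F -> et * DA <= A ->
  F1 <= - (2 * K * pl / (n * S) * D) + m * B ->
  m * A1 <= - A + 2 * K * pu * D ->
  m * B1 <= - B + 2 * K * pu * DA + 2 * K * pu * (X * D ^+ 2) ->
  F <= 8 * Z * n ^+ 2 * pu * S ^+ 2 * g ^+ 2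
       / (m * K * et * pl ^+ 2 * ca * sg ^+ 2) ->
  m * K < et ^+ 2 * pl * sg / (16 * n * pu ^+ 2 * S * g) ->
  m * K < n * S / (2 * pl) ->
  64 * Z * X * n ^+ 3 * pu ^+ 2 * S ^+ 3 * g ^+ 2
    / (et ^+ 3 * pl ^+ 3 * ca * sg ^+ 2) < K ->
  F1 + et * pl / (2 * n * pu * S) * (m * A1) + 2 * m ^+ 2 * B1 <=
  - (K * pl / (2 * n * S)) *
    (F + et * pl / (2 * n * pu * S) * (m * A) + 2 * m ^+ 2 * B).
Proof.
move=> n0 S0 pl0 pu0 et0 K0 m0 /andP[sg0 sgg] ca0 X0 F0 A0 B0 D0 FD DF DAA.
move=> hF1 hA1 hB1 hF h3a1 h3a2 h3c.
have g0 : 0 < g by exact: lt_le_trans sgg.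
have nz : (n != 0) && (S != 0) && (pl != 0) && (pu != 0) && (et != 0) &&
   (K != 0) && (m != 0) && (sg != 0) && (g != 0) && (ca != 0).
  by rewrite !gt_eqF.
move: nz; do ![case/andP]; move=> n_ S_ pl_ pu_ et_ K_ m_ sg_ g_ ca_.
set lam := K * pl / (2 * n * S).
set kap := et * pl / (2 * n * pu * S).
have lam0 : 0 < lam by rewrite divr_gt0 ?mulr_gt0.
have kap0 : 0 < kap by rewrite divr_gt0 ?mulr_gt0.
have e1 : F1 <= - (4 * lam * F) + m * B.
  apply: le_trans hF1 _; rewrite lerD2r lerN2.
  have -> : 2 * K * pl / (n * S) * D = 4 * lam * D.
    by rewrite /lam; field; rewrite n_ S_.
  by rewrite ler_pM2l// mulr_gt0.
have e2 : kap * (m * A1) <= - (kap * A) + 2 * lam * F.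
  have -> : 2 * lam * F = kap * (2 * K * pu * (F / et)).
    by rewrite /lam /kap; field; rewrite n_ S_ pu_ et_.
  rewrite -mulrN -mulrDr ler_pM2l//; apply: le_trans hA1 _.
  by rewrite lerD2l ler_pM2l ?mulr_gt0// ler_pdivlMr// mulrC.
(* The first smallness condition on [m * K], after discarding the ratio [sg / g <= 1]. *)
have e3 : 4 * m * K * pu / et <= kap / 2.
  have h : m * K <= et ^+ 2 * pl / (16 * n * pu ^+ 2 * S).
    apply: le_trans (ltW h3a1) _.
    have -> : et ^+ 2 * pl * sg / (16 * n * pu ^+ 2 * S * g) =
       et ^+ 2 * pl / (16 * n * pu ^+ 2 * S) * (sg / g).
      by field; rewrite n_ S_ pu_ g_.
    rewrite -[leRHS]mulr1 ler_wpM2l//.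
      by rewrite divr_ge0 ?mulr_ge0 ?exprn_ge0// ltW.
    by rewrite ler_pdivrMr// mul1r.
  have -> : 4 * m * K * pu / et = 4 * pu / et * (m * K) by ring.
  have -> : kap / 2 = 4 * pu / et * (et ^+ 2 * pl / (16 * n * pu ^+ 2 * S)).
    by rewrite /kap; field; rewrite n_ S_ pu_ et_.
  by rewrite ler_pM2l// divr_gt0// mulr_gt0.
have e4 : lam * m <= 1 / 4.
  have -> : lam * m = pl / (2 * n * S) * (m * K) by rewrite /lam; ring.
  have -> : 1 / 4 = pl / (2 * n * S) * (n * S / (2 * pl)) :> R.
    by field; rewrite n_ S_ pl_.
  by rewrite ler_pM2l ?divr_gt0 ?mulr_gt0// ltW.
(* Of the two factors in [D ^+ 2 <= F * (F / et ^+ 2)], one is replaced by the assumed bound on [F];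
   the largeness of [K] then makes the coefficient of the other at most [lam]. *)
have e5 : 4 * m * K * pu * (X * D ^+ 2) <= lam * F.
  have DF2 : D ^+ 2 <= F * (F / et ^+ 2).
    have -> : F * (F / et ^+ 2) = (F / et) ^+ 2 by field; rewrite et_.
    by rewrite lerXn2r ?nnegrE ?divr_ge0// ?(ltW et0)// ler_pdivlMr// mulrC.
  apply: (@le_trans _ _ (4 * m * K * pu * (X * (F * (F / et ^+ 2))))).
    by rewrite ler_wpM2l ?mulr_ge0 ?(ltW m0) ?(ltW K0) ?(ltW pu0)// ler_wpM2l.
  have -> : 4 * m * K * pu * (X * (F * (F / et ^+ 2))) =
    4 * m * K * pu * X / et ^+ 2 * F * F by ring.
  rewrite ler_wpM2r//.
  apply: le_trans (_ : 4 * m * K * pu * X / et ^+ 2 *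
      (8 * Z * n ^+ 2 * pu * S ^+ 2 * g ^+ 2
       / (m * K * et * pl ^+ 2 * ca * sg ^+ 2)) <= _).
    rewrite ler_wpM2l// divr_ge0 ?exprn_ge0 ?(ltW et0)//.
    by rewrite !mulr_ge0 ?(ltW m0) ?(ltW K0) ?(ltW pu0).
  have -> : 4 * m * K * pu * X / et ^+ 2 *
      (8 * Z * n ^+ 2 * pu * S ^+ 2 * g ^+ 2
       / (m * K * et * pl ^+ 2 * ca * sg ^+ 2)) =
    pl / (2 * n * S) * (64 * Z * X * n ^+ 3 * pu ^+ 2 * S ^+ 3 * g ^+ 2
    / (et ^+ 3 * pl ^+ 3 * ca * sg ^+ 2)).
    by field; rewrite n_ S_ pl_ et_ m_ K_ ca_ sg_.
  have -> : lam = pl / (2 * n * S) * K by rewrite /lam; ring.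
  by rewrite ler_pM2l ?divr_gt0 ?mulr_gt0// ltW.
have e6 : 2 * m ^+ 2 * B1 <= - (2 * m * B) + kap / 2 * A + lam * F.
  have : 2 * m * (m * B1) <=
      2 * m * (- B + 2 * K * pu * DA + 2 * K * pu * (X * D ^+ 2)).
    by rewrite ler_pM2l// mulr_gt0.
  have : 4 * m * K * pu * DA <= kap / 2 * A.
    apply: (@le_trans _ _ (4 * m * K * pu / et * A)); last by rewrite ler_wpM2r.
    have -> : 4 * m * K * pu / et * A = 4 * m * K * pu * (A / et) by ring.
    by rewrite ler_pM2l ?mulr_gt0// ler_pdivlMr// mulrC.
  lra.
(* Adding [e1], [e2] and [e6] gives [- lam * F - kap / 2 * A - m * B]. By [e4] the last two terms
   exceed in size the shares of [A] and [B] in [lam] times the energy. *)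
have e7 : lam * m * (kap * A) <= 1 / 4 * (kap * A).
  by rewrite ler_wpM2r// mulr_ge0// ltW.
have e8 : lam * m * (2 * m * B) <= 1 / 4 * (2 * m * B).
  by rewrite ler_wpM2r// !mulr_ge0// ltW.
have kA : 0 <= kap * A by rewrite mulr_ge0// ltW.
have mB : 0 <= m * B by rewrite mulr_ge0// ltW.
lra.
Qed.

(** A statement at one fixed time: [th], [w], [a], [b], [s] are the values of the phases and of
    their first four derivatives. The left side is the slope of the branch given by [l1], [l2],
    [l3]. *)
Lemma E2_rate (R : realType) (N : nat) (c K m alpha Dinf Z g : R)
    (psi : 'M[R]_N) (l1 l2 l3 : 'S_N) (th w a b s : 'I_N -> R) :
  (2 <= N)%N -> 2 < c -> 0 < K -> 0 < m -> 0 < sin g <= g ->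
  0 < cos alpha -> 0 <= sin alpha -> 0 < Dinf ->
  (forall i j, 0 <= psi i j) -> symmetric_network psi ->
  connected_network psi ->
  (forall i j, `|th j - th i| <= Dinf) ->
  (forall i j, 2 / c <= cos (th j - th i + alpha)) ->
  sorts l1 w -> sorts l2 a -> sorts l3 b ->
  (forall i, m * b i + a i =
     coupling K psi (fun i j => cos (th j - th i + alpha) * (w j - w i)) i) ->
  (forall i, m * s i + b i =
     coupling K psi (fun i j => cos (th j - th i + alpha) * (a j - a i)) i
     + coupling K psi
         (fun i j => - (sin (th j - th i + alpha) * (w j - w i) ^+ 2)) i) ->
  Y c w <= 8 * Z * N%:R ^+ 2 * psi_upper psi * geom_sum N c ^+ 2 * g ^+ 2
       / (m * K * eta c * psi_lower psi ^+ 2 * cos alpha * sin g ^+ 2) ->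
  m * K < eta c ^+ 2 * psi_lower psi * sin g
    / (16 * N%:R * psi_upper psi ^+ 2 * geom_sum N c * g) ->
  m * K < N%:R * geom_sum N c / (2 * psi_lower psi) ->
  64 * Z * (Dinf * cos alpha + sin alpha) * N%:R ^+ 3 * psi_upper psi ^+ 2
    * geom_sum N c ^+ 3 * g ^+ 2
    / (eta c ^+ 3 * psi_lower psi ^+ 3 * cos alpha * sin g ^+ 2) < K ->
  rank_sum c l1 a
  + eta c * psi_lower psi / (2 * N%:R * psi_upper psi * geom_sum N c)
    * (m * rank_sum c l2 b)
  + 2 * m ^+ 2 * rank_sum c l3 s
  <= - (K * psi_lower psi / (2 * N%:R * geom_sum N c)) *
     (Y c w
      + eta c * psi_lower psi / (2 * N%:R * psi_upper psi * geom_sum N c)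
        * (m * Y c a)
      + 2 * m ^+ 2 * Y c b).
Proof.
move=> N2 c2 K0 m0 hg ca0 sa0 D0 psi0 psis psic hth hcos s1 s2 s3 eb es.
move=> hF h3a1 h3a2 h3c.
have c1 : 1 < c by lra.
have c0 : 0 < c by lra.
have N0 := ltnW N2.
have pl0 := psi_lower_gt0 N2 psic.
have pu0 : 0 < psi_upper psi.
  have [i [j pij]] := connected_edge N2 psic.
  exact: lt_le_trans pij (psi_le_upper psi0 pij).
have et0 : 0 < eta c by rewrite /eta subr_gt0 ltr_pdivrMr//; lra.
have cosb z i j : `|cos (th j - th i + alpha) * (z j - z i)| <= diam z.
  rewrite normrM -[leRHS]mul1r; apply: ler_pM => //; first exact: cos_max.
  exact: diam_ge.
have sinb i j : `|sin (th j - th i + alpha)| <= Dinf * cos alpha + sin alpha.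
  rewrite sinD; apply: le_trans (ler_normD _ _) _; apply: lerD.
    rewrite normrM (gtr0_norm ca0) ler_wpM2r ?(ltW ca0)//.
    apply: le_trans (hth i j).
    exact: norm_sin_le.
  rewrite normrM (ger0_norm sa0) -[leRHS]mul1r ler_wpM2r//; exact: cos_max.
have hu i j : 2 / c <= cos (th j - th i + alpha) <= 1.
  by rewrite hcos cos_le1.
apply: (@decay_arith R _ _ _ _ _ _ _ (sin g) g (cos alpha) Z
  (Dinf * cos alpha + sin alpha) (diam w) _ _ _ _ _ _ (diam a)) => //.
- by rewrite ltr0n.
- exact: geom_sum_gt0.
- by rewrite addr_ge0 ?mulr_ge0 ?(ltW ca0) ?(ltW D0).
- exact: Y_ge0.
- exact: Y_ge0.
- exact: Y_ge0.
- exact: diam_ge0.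
- exact: Y_le_diam.
- exact: eta_diam_le_Y.
- exact: eta_diam_le_Y.
- rewrite (_ : a = fun i => 1 * coupling K psi (fun i j =>
      cos (th j - th i + alpha) * (w j - w i)) i + (- m) * b i); last first.
    by apply/funext => i; rewrite -eb; ring.
  rewrite rank_sum_linear mul1r; apply: lerD; first exact: rank_sum_decay.
  by rewrite mulNr -mulrN ler_pM2l// lerNl rank_sum_ge_NY.
(* Writing [Y c a] through the same permutation [l2] makes the damping term exact. The zero multiple
   of [b] only provides the two-term shape of [rank_sum_linear]. *)
- rewrite (Y_sorts c s2) -[m * _]addr0 -[0](mul0r (rank_sum c l2 b)).
  rewrite -rank_sum_linear.
  rewrite (_ : (fun i => _) = fun i => 1 * coupling K psi (fun i j =>
      cos (th j - th i + alpha) * (w j - w i)) i + (- 1) * a i); last first.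
    by apply/funext => i; rewrite -eb; ring.
  rewrite rank_sum_linear mul1r mulN1r addrC lerD2l.
  exact: rank_sum_coupling.
- rewrite (Y_sorts c s3) -[m * _]addr0 -[0](mul0r (rank_sum c l3 b)).
  rewrite -rank_sum_linear.
  rewrite (_ : (fun i => _) = fun i => 1 * (1 * coupling K psi (fun i j =>
      cos (th j - th i + alpha) * (a j - a i)) i + 1 * coupling K psi
         (fun i j => - (sin (th j - th i + alpha) * (w j - w i) ^+ 2)) i)
      + (- 1) * b i); last first.
    by apply/funext => i; rewrite !mul1r -es; ring.
  rewrite rank_sum_linear rank_sum_linear !mul1r mulN1r addrC -[leRHS]addrA.
  rewrite lerD2l; apply: lerD; first exact: rank_sum_coupling.
  apply: rank_sum_coupling => // i j.
  rewrite normrN normrM; apply: ler_pM => //.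
  by rewrite normrX lerXn2r ?nnegrE ?diam_ge0// diam_ge.
Qed.

(** * Derivatives and finite maxima *)

(** A first-order error bound has no quotient to guard at [s = t], passes to maxima of branches, and
    restricts to a half-line. *)
Lemma is_deriveP (R : realType) (f : R -> R) (t d : R) :
  is_derive t 1 f d <->
  forall e, 0 < e ->
    \forall s \near t, `|f s - f t - d * (s - t)| <= e * `|s - t|.
Proof.
split=> [[dft <-] e e0|H].
  have /cvgrPdist_le/(_ _ e0) :
      h^-1 *: (f (h *: 1 + t) - f t) @[h --> 0^'] --> 'D_1 f t.
    exact: dft.
  move=> /nbhs_ballP[r r0 hr]; apply/nbhs_ballP; exists r => // s ts.
  have [->|st] := eqVneq s t; first by rewrite !subrr mulr0 subr0 normr0 mulr0.
  have st0 : s - t != 0 by rewrite subr_eq0.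
  have := hr (s - t); rewrite /ball/= sub0r normrN distrC => /(_ ts st0).
  rewrite /GRing.scale/= mulr1 subrK => h.
  rewrite -(@ler_pM2r _ `|s - t|) ?normr_gt0// -normrM in h.
  rewrite [in leRHS]distrC -[leLHS]normrN.
  congr (`|_| <= _): h.
  by rewrite mulrBl mulrAC (mulVf st0) mul1r [RHS]opprB.
have cv : h^-1 *: (f (h *: 1 + t) - f t) @[h --> 0^'] --> d.
  apply/cvgrPdist_le => e /H/nbhs_ballP[r r0 hr].
  apply/nbhs_ballP; exists r => // h.
  rewrite /ball/= sub0r normrN => hr' h0.
  have := hr (t + h).
  rewrite /ball/= opprD addrA subrr sub0r normrN => /(_ hr').
  rewrite /GRing.scale/= mulr1 [t + h]addrC addrK => hh.
  rewrite -(@ler_pM2r _ `|h|) ?normr_gt0// -normrM -[leLHS]normrN.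
  congr (`|_| <= _): hh.
  by rewrite mulrBl mulrAC (mulVf h0) mul1r [RHS]opprB.
by apply: DeriveDef; [apply/cvg_ex; exists d|exact/cvg_lim].
Qed.

Lemma cvg_ge0P (R : realType) (f : R -> R) (t d : R) :
  ((f s - f t) / (s - t) @[s --> within [set s : R | 0 <= s] t^'] --> d) <->
  forall e, 0 < e -> \forall s \near t,
    0 <= s -> `|f s - f t - d * (s - t)| <= e * `|s - t|.
Proof.
have eq (s e : R) : s != t -> (`|d - (f s - f t) / (s - t)| <= e) =
    (`|f s - f t - d * (s - t)| <= e * `|s - t|).
  move=> st; have st0 : s - t != 0 by rewrite subr_eq0.
  rewrite -[in RHS](ler_pM2r (_ : 0 < `|s - t|^-1)) ?invr_gt0 ?normr_gt0//.
  rewrite mulfK ?normr_eq0// -normfV -normrM -[in LHS]normrN.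
  congr (`|_| <= _); field.
  exact: st0.
split=> [/cvgrPdist_le H e e0|H]; last apply/cvgrPdist_le => e e0.
  have := H e e0 => /nbhs_ballP[r r0 hr].
  apply/nbhs_ballP; exists r => // s ts s0.
  have [->|st] := eqVneq s t; first by rewrite !subrr mulr0 subr0 normr0 mulr0.
  by rewrite -eq//; exact: hr.
have := H e e0 => /nbhs_ballP[r r0 hr].
apply/nbhs_ballP; exists r => // s ts st s0.
by rewrite eq//; exact: hr.
Qed.

Lemma within_ge0_proper (R : realType) (t : R) : 0 <= t ->
  ProperFilter (within [set s : R | 0 <= s] t^').
Proof.
move=> t0; apply: Build_ProperFilter_ex => P /nbhs_ballP[r /= r0 hr].
exists (t + r / 2); apply: hr => /=.
- by rewrite /ball/= opprD addrA subrr sub0r normrN gtr0_norm; lra.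
- by apply/eqP; lra.
- by rewrite addr_ge0//; lra.
Qed.

(** The half-line derivative sees only nonnegative times. This identifies the jerk although [acc]
    and [accel] may differ before time 0. *)
Lemma derive_ge0_eq (R : realType) (f h : R -> R) (t d : R) : 0 <= t ->
  (forall s, 0 <= s -> f s = h s) -> is_derive t 1 h d -> derive_ge0 f t = d.
Proof.
move=> t0 fh /is_deriveP H; have PF := within_ge0_proper t0.
apply/cvg_lim => //; apply/cvg_ge0P => e /H; apply: filterS => s hs s0.
by rewrite !fh.
Qed.

(* The affine extension to t < 0 turns the one-sided derivative at 0 into a
   two-sided one. *)
Definition extend_left (R : realType) (f : R -> R) (t : R) : R :=
  if 0 <= t then f t else f 0 + derive_ge0 f 0 * t.

Lemma is_derive_extend_left (R : realType) (f : R -> R) (t : R) : 0 <= t ->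
  derivable_ge0 f t -> is_derive t 1 (extend_left f) (derive_ge0 f t).
Proof.
move=> t0 /(cvg_ge0P f t (derive_ge0 f t)).1 H; apply/is_deriveP => e e0.
have := H e e0; rewrite /extend_left t0.
move: t0; rewrite le_eqVlt => /orP[/eqP <-|t0].
  apply: filterS => s; case: ifP => [_ /(_ isT)//|_ _].
  rewrite subr0 addrAC addrK subrr normr0 mulr_ge0// ltW//.
apply: filterS2 (lt_nbhsr t0) => s s0; rewrite (ltW s0); exact.
Qed.

(** Near [t] the inactive branches stay strictly below [f], so [f s] is attained by a branch active
    at [t]. All these share the value [f t] and the slope [d], and finitely many branches admit a
    common neighbourhood. *)
Lemma is_derive_max (R : realType) (T : finType) (g : T -> R -> R)
    (dg : T -> R) (f : R -> R) (t d : R) :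
  (forall p s, g p s <= f s) -> (forall s, exists p, f s = g p s) ->
  (forall p, is_derive t 1 (g p) (dg p)) ->
  (forall p, g p t = f t -> dg p = d) ->
  is_derive t 1 f d.
Proof.
move=> gf fg gD hd; apply/is_deriveP => e e0.
have near1 : \forall s \near t, forall p,
    `|g p s - g p t - dg p * (s - t)| <= e * `|s - t|.
  apply: (@filter_forall R T (fun p s =>
    `|g p s - g p t - dg p * (s - t)| <= e * `|s - t|) (nbhs t) _) => p.
  by have /is_deriveP/(_ e e0) := gD p.
have [p0 fp0] := fg t.
have cg p : g p s @[s --> t] --> g p t.
  by apply: differentiable_continuous; apply/derivable1_diffP; case: (gD p).
have near2 : \forall s \near t, forall p, g p t < f t -> g p s < f s.
  apply: (@filter_forall R T (fun p s => g p t < f t -> g p s < f s)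
    (nbhs t) _) => p.
  have [pt|pt] := ltP (g p t) (f t); last by apply: nearW.
  (* The midpoint separates the inactive branch [p] from the active branch [p0] near [t]. *)
  have [y1 y2] : g p t < (g p t + f t) / 2 /\ (g p t + f t) / 2 < g p0 t.
    by rewrite -fp0; lra.
  apply: filterS2 (cvgr_lt _ (cg p) _ y1) (cvgr_gt _ (cg p0) _ y2) => s a b _.
  by apply: lt_le_trans (gf p0 s); exact: lt_trans b.
apply: filterS2 near1 near2 => s h1 h2.
have [p fp] := fg s.
have pt : g p t = f t.
  apply/eqP; rewrite eq_le gf leNgt; apply/negP => /h2.
  by rewrite fp ltxx.
by rewrite fp -pt -(hd p pt).
Qed.

(* Transversal zeros are isolated, hence separated by rational intervals. *)
Lemma countable_crossings (R : realType) (h dh : R -> R) (D : set R) :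
  (forall t, D t -> is_derive t 1 h (dh t)) ->
  countable [set t | [/\ D t, h t = 0 & dh t != 0]].
Proof.
move=> hD.
pose I (q : rat * rat) := [set t | h t = 0 /\ ratr q.1 < t < ratr q.2 /\
  forall s, ratr q.1 < s < ratr q.2 -> h s = 0 -> s = t].
apply: (@sub_countable _ _ _ (\bigcup_q I q)); last first.
  apply: bigcup_countable => // q _.
  have [[t It]|no] := pselect (exists t, I q t).
    apply: (@sub_countable _ _ _ [set t]) => //.
    by apply: subset_card_le => s [hs [qs _]]; case: It => _ [_]; exact.
  rewrite (_ : I q = set0)//; apply/seteqP; split=> // t It.
  by apply: no; exists t.
apply: subset_card_le => t [Dt ht dht].
(* With tolerance half the slope, a second zero nearby would give [|dh t| <= |dh t| / 2]. *)
have e0 : 0 < `|dh t| / 2 by rewrite divr_gt0// normr_gt0.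
have /is_deriveP/(_ _ e0)/nbhs_ballP[r /= r0 hr] := hD t Dt.
have [|p /andP[]] := @rat_in_itvoo R (t - r) t; first by rewrite gtrBl.
rewrite !bnd_simp => p1 p2.
have [|q /andP[]] := @rat_in_itvoo R t (t + r); first by rewrite ltrDl.
rewrite !bnd_simp => q1 q2.
exists (p, q) => //; split=> //=; split; first by rewrite p2.
move=> s /andP[ps sq] hs; apply/eqP/negPn/negP => st.
have := hr s; rewrite /ball/= ltr_norml => /(_ _)/wrap[].
  by apply/andP; split; lra.
rewrite hs ht subrr sub0r normrN normrM leNgt => /negP; apply.
rewrite ltr_pM2r ?normr_gt0 ?subr_eq0//.
by rewrite ltr_pdivrMr// mulr2n mulrDr mulr1 ltrDl normr_gt0.
Qed.

(** Uses the branch slopes at every time, and so takes the place of integrating a differential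
    inequality for the maximum that holds only almost everywhere. *)
Lemma finite_max_nonincreasing (R : realType) (T : finType) (g dg : T -> R -> R)
    (a b : R) : a <= b ->
  (forall p t, a <= t <= b -> is_derive t 1 (g p) (dg p t)) ->
  (forall p t, a < t <= b -> (forall q, g q t <= g p t) -> dg p t <= 0) ->
  forall p, exists q, g p b <= g q a.
Proof.
rewrite le_eqVlt => /orP[/eqP <- _ _ p|ab gD gN p]; first by exists p.
pose q := [arg max_(q > p) g q a]%O.
have qP r : g r a <= g q a by rewrite /q; case: arg_maxP => // x _; apply.
exists q; apply/ler_addgt0Pr => e0 e0_gt0.
pose e := e0 / (b - a).
have e_gt0 : 0 < e by rewrite divr_gt0// subr_gt0.
(* The maximum over p and t of g p t - e t is attained at t = a: at a later time
   the maximizing branch is active and g p t - e t has slope at most - e < 0. *)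
suff : g p b - e * b <= g q a - e * a.
  have : e * (b - a) = e0 by rewrite /e; field; lra.
  lra.
have /fin_all_exists2[x xab xmax] r : exists2 x, x \in `[a, b] &
    forall s, s \in `[a, b] -> g r s - e * s <= g r x - e * x.
  apply: EVT_max; first exact: ltW.
  apply: derivable_within_continuous => s; rewrite in_itv/= => sab.
  have := gD r s sab => ?; exact: ex_derive.
pose r := [arg max_(r > p) (g r (x r) - e * x r)]%O.
have rP k : g k (x k) - e * x k <= g r (x r) - e * x r.
  by rewrite /r; case: arg_maxP => // y _; apply.
have b_in : b \in `[a, b] by rewrite in_itv/= lexx ltW.
apply: le_trans (xmax p b b_in) _; apply: le_trans (rP p) _.
have := xab r; rewrite in_itv/= => /andP[].
rewrite le_eqVlt => /orP[/eqP <- _|axr xrb]; first by rewrite lerD2r.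
have act k : g k (x r) <= g r (x r).
  by have := le_trans (xmax k _ (xab r)) (rP k); rewrite lerD2r.
have := gN r (x r); rewrite axr => /(_ xrb act) d0.
have e2 : 0 < e / 2 by rewrite divr_gt0.
have xr : a <= x r <= b by rewrite xrb ltW.
have /is_deriveP/(_ _ e2)/nbhs_ballP[d /= d0' hd] := gD r (x r) xr.
exfalso.
(* A time shortly before [x r], still in the interval. With slope at most 0 and error at most
   [e / 2] per unit of time, the tilted branch is larger at [s] than at its maximizer. *)
pose s := Num.max a (x r - d / 2).
have sx : s < x r by rewrite gt_max axr/=; lra.
have sa : a <= s by rewrite le_max lexx.
have sd : x r - d / 2 <= s by rewrite le_max lexx orbT.
have := hd s; rewrite /ball/= gtr0_norm ?subr_gt0// => /(_ _)/wrap[]; first lra.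
rewrite [`|s - _|]distrC [`|x r - s|]gtr0_norm ?subr_gt0//.
rewrite ler_norml => /andP[lo _].
have := xmax r s; rewrite in_itv/= sa/= => /(_ _)/wrap[]; first lra.
have : 0 <= dg r (x r) * (s - x r) by rewrite mulr_le0//; lra.
have : 0 < e * (x r - s) by rewrite mulr_gt0// subr_gt0.
lra.
Qed.

(** Multiplying all branches by the same positive factor [expR (lam * (s - a))] keeps the active
    ones active and turns the rate [- lam] into a nonpositive slope. *)
Lemma finite_max_gronwall (R : realType) (T : finType) (g dg : T -> R -> R)
    (f : R -> R) (lam a : R) :
  (forall p t, g p t <= f t) -> (forall t, exists p, f t = g p t) ->
  (forall p t, a <= t -> is_derive t 1 (g p) (dg p t)) ->
  (forall p t, a <= t -> g p t = f t -> dg p t <= - lam * f t) ->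
  forall t, a <= t -> f t <= f a * expR (- lam * (t - a)).
Proof.
move=> gf fg gD gN t at_.
pose E s := expR (lam * (s - a)).
have ED (s : R) : is_derive s 1 E (lam * E s).
  have : is_derive s 1 (fun s => lam * (s - a)) lam.
    by apply: is_derive_eq; rewrite subr0 /GRing.scale/= mulr1.
  move=> ?; apply: is_derive_eq (is_derive1_comp _ _) _.
  by rewrite mulrC.
have [p fp] := fg t.
have [||q] := @finite_max_nonincreasing R T (fun p s => E s * g p s)
  (fun p s => E s * dg p s + lam * E s * g p s) a t at_ _ _ p.
- move=> k s /andP[as_ _]; have := gD k s as_ => ?.
  apply: is_derive_eq; rewrite /GRing.scale/=; ring.
- move=> k s /andP[as_ _] kmax.
  have ks : g k s = f s.
    apply/eqP; rewrite eq_le gf; have [j ->] := fg s.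
    by have := kmax j; rewrite ler_pM2l ?expR_gt0.
  have := gN k s (ltW as_) ks; rewrite ks => hs.
  have : E s * dg k s <= E s * (- lam * f s) by rewrite ler_pM2l ?expR_gt0.
  lra.
rewrite -fp /E subrr mulr0 expR0 mul1r => h.
rewrite mulNr expRN ler_pdivlMr ?expR_gt0// mulrC.
by apply: le_trans h _; exact: gf.
Qed.

Lemma countable_negligible (R : realType) (X : set R) :
  countable X -> (@lebesgue_measure R).-negligible X.
Proof.
move=> Xc; exists X; split=> //; last exact: countable_lebesgue_measure0.
exact: countable_measurable.
Qed.

Lemma countable_transversal_ties (R : realType) (T : finType)
    (g dg : T -> R -> R) (D : set R) :
  (forall p t, D t -> is_derive t 1 (g p) (dg p t)) ->
  countable [set t | D t /\ exists p q, g p t = g q t /\ dg p t != dg q t].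
Proof.
move=> gD.
pose X (pq : T * T) := [set t | [/\ D t, g pq.1 t - g pq.2 t = 0 &
  dg pq.1 t - dg pq.2 t != 0]].
apply: (@sub_countable _ _ _ (\bigcup_pq X pq)).
  apply: subset_card_le => t [Dt [p [q [gpq dpq]]]]; exists (p, q) => //.
  by split=> //=; [rewrite gpq subrr|rewrite subr_eq0].
apply: bigcup_countable => [|pq _]; first exact: countableP.
apply: (@countable_crossings R (fun t => g pq.1 t - g pq.2 t)
  (fun t => dg pq.1 t - dg pq.2 t)) => t Dt.
by have := gD pq.1 t Dt => ?; have := gD pq.2 t Dt => ?; exact: is_derive_eq.
Qed.

(** * Higher derivatives of a solution *)

Lemma is_derive_lincomb (R : realType) (n : nat) (k : 'I_n -> R)
    (h : 'I_n -> R -> R) (dh : 'I_n -> R) (t : R) :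
  (forall j, is_derive t 1 (h j) (dh j)) ->
  is_derive t 1 (fun s => \sum_j k j * h j s) (\sum_j k j * dh j).
Proof.
move=> hD.
rewrite (_ : (fun s => _) = \sum_j (k j *: h j)); last first.
  by apply/funext => s; rewrite fct_sumE.
by apply: is_derive_sum => j; have := hD j => ?; exact: is_derive_eq.
Qed.

Lemma is_derive_coupling (R : realType) (N : nat) (K : R) (psi : 'M[R]_N)
    (x : 'I_N -> 'I_N -> R -> R) (dx : 'I_N -> 'I_N -> R) (t : R) (i : 'I_N) :
  (forall i j, is_derive t 1 (x i j) (dx i j)) ->
  is_derive t 1 (fun s => coupling K psi (fun i j => x i j s) i)
    (coupling K psi dx i).
Proof.
move=> xD; have := is_derive_lincomb (psi i) (xD i) => ?.
exact: is_derive_eq.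
Qed.

Lemma is_derive_rank_sum (R : realType) (N : nat) (c : R) (l : 'S_N)
    (z : 'I_N -> R -> R) (dz : 'I_N -> R) (t : R) :
  (forall i, is_derive t 1 (z i) (dz i)) ->
  is_derive t 1 (fun s => rank_sum c l (fun i => z i s)) (rank_sum c l dz).
Proof.
move=> zD.
exact: (is_derive_lincomb (fun i => rank_weight c i) (fun i => zD (l i))).
Qed.

Lemma is_derive_mul_diff (R : realType) (u x y : R -> R) (du dx dy t : R) :
  is_derive t 1 u du -> is_derive t 1 x dx -> is_derive t 1 y dy ->
  is_derive t 1 (fun s => u s * (y s - x s))
    (u t * (dy - dx) + du * (y t - x t)).
Proof.
by move=> ? ? ?; apply: is_derive_eq; rewrite /GRing.scale/= [_ * du]mulrC.
Qed.

Section Extension.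
Variables (R : realType) (N : nat) (m K alpha : R) (Omega : 'I_N -> R).
Variables (psi : 'M[R]_N) (theta : 'I_N -> R -> R).

Definition phase (i : 'I_N) : R -> R := extend_left (theta i).
Definition freq (i : 'I_N) : R -> R := extend_left (omega theta i).
Definition lag (i j : 'I_N) (t : R) : R := phase j t - phase i t + alpha.
(* The second to fourth derivatives of the phases, read off the equation:
   defined for all t, they are the actual derivatives for t >= 0. *)
Definition accel (i : 'I_N) (t : R) : R :=
  m^-1 * (Omega i + coupling K psi (fun i j => sin (lag i j t)) i - freq i t).
Definition jolt (i : 'I_N) (t : R) : R :=
  m^-1 * (coupling K psi (fun i j =>
            cos (lag i j t) * (freq j t - freq i t)) i - accel i t).
Definition snap (i : 'I_N) (t : R) : R :=
  m^-1 * (coupling K psi (fun i j =>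
            cos (lag i j t) * (accel j t - accel i t)
            - sin (lag i j t) * (freq j t - freq i t) ^+ 2) i - jolt i t).

Hypothesis m0 : 0 < m.
Hypothesis sol : kuramoto_solution m K alpha Omega psi theta.

Lemma phaseE (i : 'I_N) (t : R) : 0 <= t -> theta i t = phase i t.
Proof. by rewrite /phase /extend_left => ->. Qed.

Lemma freqE (i : 'I_N) (t : R) : 0 <= t -> omega theta i t = freq i t.
Proof. by rewrite /freq /extend_left => ->. Qed.

Lemma accelE (i : 'I_N) (t : R) : 0 <= t -> acc theta i t = accel i t.
Proof.
move=> t0; have [_ _ e] := sol i t0.
rewrite /accel -(freqE i t0) (_ : coupling _ _ _ _ = K / N%:R *
  \sum_(j < N) psi i j * sin (theta j t - theta i t + alpha)); last first.
  rewrite /coupling; congr (_ * _); apply: eq_bigr => j _.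
  by rewrite /lag !phaseE.
by rewrite addrC in e; rewrite -e addrAC subrr add0r mulKf// gt_eqF.
Qed.

Lemma is_derive_phase (i : 'I_N) (t : R) : 0 <= t ->
  is_derive t 1 (phase i) (freq i t).
Proof.
move=> t0; have [d _ _] := sol i t0; rewrite -(freqE i t0).
exact: is_derive_extend_left t0 d.
Qed.

Lemma is_derive_freq (i : 'I_N) (t : R) : 0 <= t ->
  is_derive t 1 (freq i) (accel i t).
Proof.
move=> t0; have [_ d _] := sol i t0; rewrite -(accelE i t0).
exact: is_derive_extend_left t0 d.
Qed.

Lemma is_derive_lag (i j : 'I_N) (t : R) : 0 <= t ->
  is_derive t 1 (lag i j) (freq j t - freq i t).
Proof.
move=> t0; have := is_derive_phase i t0 => ?; have := is_derive_phase j t0 => ?.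
by apply: is_derive_eq; rewrite addr0.
Qed.

(** Regularity is bootstrapped: [accel] is an expression in phases and frequencies, which are
    differentiable by the definition of a solution, so a third derivative of the phases exists. *)
Lemma is_derive_accel (i : 'I_N) (t : R) : 0 <= t ->
  is_derive t 1 (accel i) (jolt i t).
Proof.
move=> t0.
have dsin i' j' : is_derive t 1 (fun s => sin (lag i' j' s))
    (cos (lag i' j' t) * (freq j' t - freq i' t)).
  have := is_derive_lag i' j' t0 => ?.
  by apply: is_derive_eq (is_derive1_comp _ _) _; rewrite /GRing.scale/= mulrC.
have := is_derive_coupling K psi i dsin => ?.
have := is_derive_freq i t0 => ?.
by apply: is_derive_eq; rewrite /jolt /GRing.scale/=; ring.
Qed.

Lemma joltE (i : 'I_N) (t : R) : 0 <= t -> jerk theta i t = jolt i t.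
Proof.
move=> t0; apply: (derive_ge0_eq t0 (h := accel i)) => [s|].
  exact: accelE.
exact: is_derive_accel.
Qed.

Lemma is_derive_jolt (i : 'I_N) (t : R) : 0 <= t ->
  is_derive t 1 (jolt i) (snap i t).
Proof.
move=> t0.
have dcos i' j' : is_derive t 1
    (fun s => cos (lag i' j' s) * (freq j' s - freq i' s))
    (cos (lag i' j' t) * (accel j' t - accel i' t)
     - sin (lag i' j' t) * (freq j' t - freq i' t) ^+ 2).
  have := is_derive_lag i' j' t0 => ?.
  have dc : is_derive t 1 (fun s => cos (lag i' j' s))
      (- sin (lag i' j' t) * (freq j' t - freq i' t)).
    apply: is_derive_eq (is_derive1_comp _ _) _.
    by rewrite /GRing.scale/= mulrC.
  apply: is_derive_eq
    (is_derive_mul_diff dc (is_derive_freq i' t0) (is_derive_freq j' t0)) _.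
  by rewrite !mulNr -mulrA expr2.
have := is_derive_coupling K psi i dcos => ?.
have := is_derive_accel i t0 => ?.
by apply: is_derive_eq; rewrite /snap /GRing.scale/=; ring.
Qed.

End Extension.

(** * Exponential decay *)

Theorem lemma4p4 (R : realType) (N : nat) (hN : (2 <= N)%N)
    (m K alpha : R) (hm : 0 < m) (hK : 0 < K)
    (halpha : 0 < alpha < pi / 2)
    (Omega : 'I_N -> R) (psi : 'M[R]_N)
    (psi_ge0 : forall i j : 'I_N, 0 <= psi i j)
    (psi_sym : symmetric_network psi)
    (psi_conn : connected_network psi)
    (theta : 'I_N -> R -> R)
    (theta_sol : kuramoto_solution m K alpha Omega psi theta)
    (beta gamma Dinf delta c : R)
    (hbeta : 0 < beta < pi)
    (h1 : 2 * m * diam Omega + 4 * m * K * psi_upper psi * sin alpha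
          + (1 + 4 * m * K * psi_upper psi * cos alpha)
            * diam (fun i => theta i 0)
          + 3 * m * diam (fun i => omega theta i 0) < beta)
    (hgamma : beta < gamma < pi)
    (hDinf : 0 < Dinf < Num.min (pi / 2) beta)
    (hdelta : alpha < delta < pi / 2 - Dinf)
    (hc0 : 0 < c)
    (hc : Num.max (2 / cos (Dinf + delta)) (2 / (1 - beta / gamma)) < c)
    (h3a : m * K < Num.min
        (eta c ^+ 2 * psi_lower psi * sin gamma
         / (16 * N%:R * psi_upper psi ^+ 2 * geom_sum N c * gamma))
        (N%:R * geom_sum N c / (2 * psi_lower psi)))
    (h3b : 4 * (diam Omega + 2 * K * psi_upper psi * sin alpha)
           * N%:R * geom_sum N c * gamma
           / (Dinf * eta c * psi_lower psi * cos alpha * sin gamma) < K)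
    (h3c : 64 * (diam Omega + 2 * K * psi_upper psi * sin alpha)
           * (Dinf * cos alpha + sin alpha)
           * N%:R ^+ 3 * psi_upper psi ^+ 2 * geom_sum N c ^+ 3 * gamma ^+ 2
           / (eta c ^+ 3 * psi_lower psi ^+ 3 * cos alpha * sin gamma ^+ 2) < K)
    (tstar : R) (htstar : 0 <= tstar)
    (htheta : forall t : R, tstar <= t -> diam (fun i => theta i t) < Dinf)
    (hF : forall t : R, tstar <= t ->
        F c theta t <=
          8 * (diam Omega + 2 * K * psi_upper psi * sin alpha)
          * N%:R ^+ 2 * psi_upper psi * geom_sum N c ^+ 2 * gamma ^+ 2
          / (m * K * eta c * psi_lower psi ^+ 2 * cos alpha * sin gamma ^+ 2)) :
  {ae (@lebesgue_measure R), forall t : R, tstar <= t ->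
     derivable (E2 m c psi theta) t 1 /\
     derive1 (E2 m c psi theta) t <=
       - (K * psi_lower psi / (2 * N%:R * geom_sum N c)) * E2 m c psi theta t}
  /\
  (forall t : R, tstar <= t ->
     diam (fun i => omega theta i t) <=
       E2 m c psi theta tstar / eta c
       * expR (- (K * psi_lower psi / (2 * N%:R * geom_sum N c)) * (t - tstar))).
Proof.
clear h1 h3b.
move: halpha hbeta hgamma hDinf hdelta.
move=> /andP[al0 al1] /andP[be0 be1] /andP[bg gpi].
rewrite lt_min => /andP[D0 /andP[D1 _]] /andP[ad dD].
move: hc; rewrite gt_max => /andP[hc _].
move: h3a; rewrite lt_min => /andP[h3a1 h3a2].
have N0 := ltnW hN.
have Dd : Dinf + delta < pi / 2 by rewrite addrC -ltrBrDr.
have Dd0 : 0 < Dinf + delta by rewrite addr_gt0// (lt_trans al0).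
have cD0 : 0 < cos (Dinf + delta) by apply: cos_gt0_pihalf; lra.
have Dpi : Dinf + delta < pi by apply: lt_trans Dd _; lra.
have hc' : 2 < c * cos (Dinf + delta) by rewrite -ltr_pdivrMr.
have c2 : 2 < c.
  apply: lt_le_trans hc' _; rewrite -[leRHS]mulr1 ler_wpM2l ?cos_le1 ?ltW//.
have c1 : 1 < c by apply: lt_trans c2; rewrite ltr1n.
have ca0 : 0 < cos alpha by apply: cos_gt0_pihalf; lra.
have sa0 : 0 <= sin alpha by apply/ltW/sin_gt0_pihalf; rewrite al0.
have g0 : 0 < gamma by exact: lt_trans bg.
have sg0 : 0 < sin gamma by apply: sin_gt0_pi; rewrite g0.
have hg : 0 < sin gamma <= gamma.
  by rewrite sg0 -[leRHS]gtr0_norm// (le_trans (ler_norm _))// norm_sin_le.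
have pl0 := psi_lower_gt0 hN psi_conn.
have pu0 : 0 < psi_upper psi.
  have [i [j pij]] := connected_edge hN psi_conn.
  exact: lt_le_trans pij (psi_le_upper psi_ge0 pij).
have S0 : 0 < geom_sum N c by exact: geom_sum_gt0.
have et0 : 0 < eta c by rewrite /eta subr_gt0 ltr_pdivrMr//; lra.
have n0 : 0 < N%:R :> R by rewrite ltr0n.
set kap := eta c * psi_lower psi / (2 * N%:R * psi_upper psi * geom_sum N c).
set lam := K * psi_lower psi / (2 * N%:R * geom_sum N c).
have kap0 : 0 < kap by rewrite divr_gt0 ?mulr_gt0.
have m20 : 0 < 2 * m ^+ 2 by rewrite mulr_gt0 ?exprn_gt0.
pose w t i := freq theta i t.
pose a t i := accel m K alpha Omega psi theta i t.
pose b t i := jolt m K alpha Omega psi theta i t.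
pose s t i := snap m K alpha Omega psi theta i t.
(* The energy in terms of the extended derivatives. Its branches [g] are indexed by triples of
   permutations, one for each of the three orderings. *)
pose f t := Y c (w t) + kap * (m * Y c (a t)) + 2 * m ^+ 2 * Y c (b t).
pose comb (p : 'S_N * 'S_N * 'S_N) x y z : R :=
  rank_sum c p.1.1 x + kap * (m * rank_sum c p.1.2 y)
  + 2 * m ^+ 2 * rank_sum c p.2 z.
pose g p t := comb p (w t) (a t) (b t).
pose dg p t := comb p (a t) (b t) (s t).
have wE (t : R) : 0 <= t -> (fun i => omega theta i t) = w t.
  by move=> t0; apply/funext => i; rewrite freqE.
have E2f (t : R) : 0 <= t -> E2 m c psi theta t = f t.
  move=> t0; rewrite /E2 /F /A /B wE//.
  rewrite (_ : (fun i => acc theta i t) = a t); last first.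
    by apply/funext => i; apply: accelE.
  rewrite (_ : (fun i => jerk theta i t) = b t)//.
  by apply/funext => i; apply: joltE.
have part (l : 'S_N) (k : R) x : 0 < k -> k * rank_sum c l x <= k * Y c x.
  by move=> k0; rewrite ler_pM2l// rank_sum_le_Y.
have gf p t : g p t <= f t.
  rewrite /g /comb /f !(mulrA kap); apply: lerD; last exact: (part _ _ _ m20).
  by apply: lerD; [exact: rank_sum_le_Y|apply: part; rewrite mulr_gt0].
have fg t : exists p, f t = g p t.
  have [[l1 [e1 _]] _] := Y_max (w t) c1.
  have [[l2 [e2 _]] _] := Y_max (a t) c1.
  have [[l3 [e3 _]] _] := Y_max (b t) c1.
  by exists (l1, l2, l3); rewrite /f e1 e2 e3.
have gD p (t : R) : 0 <= t -> is_derive t 1 (g p) (dg p t).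
  move=> t0.
  have := is_derive_rank_sum c p.1.1
    (fun i => is_derive_freq hm theta_sol i t0) => ?.
  have := is_derive_rank_sum c p.1.2
    (fun i => is_derive_accel hm theta_sol i t0) => ?.
  have := is_derive_rank_sum c p.2
    (fun i => is_derive_jolt hm theta_sol i t0) => ?.
  by apply: is_derive_eq; rewrite /dg /comb /GRing.scale/=; ring.
have rate p (t : R) : tstar <= t -> g p t = f t -> dg p t <= - lam * f t.
  move=> tt gft; have t0 := le_trans htstar tt.
  have [r1 r2 r3] : [/\ rank_sum c p.1.1 (w t) = Y c (w t),
      rank_sum c p.1.2 (a t) = Y c (a t) & rank_sum c p.2 (b t) = Y c (b t)].
    apply: (weighted_sum_tight _ m20 _ _ _ gft); rewrite ?rank_sum_le_Y//.
    exact: mulr_gt0.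
  have dth (i j : 'I_N) : `|phase theta j t - phase theta i t| <= Dinf.
    rewrite -!phaseE//; apply: le_trans _ (ltW (htheta t tt)).
    exact: (diam_ge (fun i => theta i t)).
  (* The argument stays within [Dinf + delta] of zero because [alpha < delta], and the lower bound
     on [c] gives [2 / c < cos (Dinf + delta)]. *)
  have dcos i j : 2 / c <= cos (lag alpha theta i j t).
    apply: (@le_trans _ _ (cos (Dinf + delta))).
      by rewrite ler_pdivrMr// mulrC ltW.
    apply: cos_ge; last by apply: ltW.
    apply: le_trans (ler_normD _ _) _; rewrite (gtr0_norm al0).
    exact: lerD (dth i j) (ltW ad).
  have eb i : m * b t i + a t i = coupling K psi (fun i j =>
      cos (lag alpha theta i j t) * (w t j - w t i)) i.
    by rewrite /b /jolt mulrA divff ?gt_eqF// mul1r subrK.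
  have es i : m * s t i + b t i =
      coupling K psi (fun i j =>
        cos (lag alpha theta i j t) * (a t j - a t i)) i
      + coupling K psi (fun i j =>
          - (sin (lag alpha theta i j t) * (w t j - w t i) ^+ 2)) i.
    rewrite /s /snap mulrA divff ?gt_eqF// mul1r subrK.
    rewrite /coupling -mulrDr -big_split/=; congr (_ * _).
    by apply: eq_bigr => j _; rewrite -mulrDr.
  have hFt := hF t tt; rewrite /F (wE t t0) in hFt.
  exact: (E2_rate (th := phase theta ^~ t) hN c2 hK hm hg ca0 sa0 D0
    psi_ge0 psi_sym psi_conn dth dcos
    (rank_sum_active c1 r1) (rank_sum_active c1 r2) (rank_sum_active c1 r3)
    eb es hFt h3a1 h3a2 h3c).
split.
  (* The exceptional set consists of the transversal ties at positive times and of time 0, where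
     [E2] is known to agree with [f] only on the right. *)
  have badc := countable_transversal_ties (D := [set t | 0 < t])
    (fun p t t0 => gD p t (ltW t0)).
  apply: negligibleS (negligibleU (countable_negligible (countable1 0))
    (countable_negligible badc)).
  move=> t /= bt; apply/not_notP => Ct; apply: bt => tt.
  have t0 : 0 < t.
    rewrite lt_neqAle (le_trans htstar tt) andbT.
    by apply/eqP => t0; apply: Ct; left.
  have [p fp] := fg t.
  have fD : is_derive t 1 f (dg p t).
    (* An active branch with a slope different from that of [p] would make [t] a transversal tie. *)
    apply: (is_derive_max gf fg (fun q => gD q t (ltW t0))) => q gq.
    apply/eqP/negPn/negP => dpq.
    by apply: Ct; right; split=> //; exists q, p; rewrite gq fp.
  have ED : is_derive t 1 (E2 m c psi theta) (dg p t).
    apply: near_eq_is_derive fD; apply: filterS (lt_nbhsr t0) => u u0.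
    by rewrite E2f// ltW.
  split; first exact: ex_derive.
  rewrite derive1E derive_val E2f ?(ltW t0)//.
  exact: rate.
move=> t tt; have t0 := le_trans htstar tt.
rewrite (wE t)// mulrAC ler_pdivlMr// mulrC.
(* The diameter is controlled by F through [eta c], and F by the whole energy since A and B are
   nonnegative; the decay of the energy then finishes the bound. *)
apply: le_trans (eta_diam_le_Y (w t) hN c2) _.
have Yf : Y c (w t) <= f t.
  rewrite /f -addrA lerDl; apply: addr_ge0.
    exact: mulr_ge0 (ltW kap0) (mulr_ge0 (ltW hm) (Y_ge0 _ hN c2)).
  exact: mulr_ge0 (ltW m20) (Y_ge0 _ hN c2).
apply: le_trans Yf _; rewrite E2f//.
by apply: (finite_max_gronwall gf fg _ rate tt) => p u tu;
  exact/gD/(le_trans htstar).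
Qed.
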